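(* For every positive integer $k$ and every large $n$, there is a set $E$ of $n$ points in $\mathbb{R}^6$ such that the number of tuples $(x_1,\dots,x_{k+2})\in E^{k+2}$ with $\angle(x_j,x_{j+1},x_{j+2})=\pi/2$ for all $1\le j\le k$ is $\approx n^{k+2}$.
   Context: $\angle(x,y,z)\in[0,\pi]$ denotes the angle at $y$ between $x-y$ and $z-y$ (for $x\ne y\ne z$). $X\approx Y$ means $cY\le X\le CY$ for all $n>N$ with positive constants $c,C,N$ independent of $n$ (possibly depending on $k$). *)

(* Defs.v *)
From HB Require Import structures.
From mathcomp Require Import all_boot all_order all_algebra finmap.
From mathcomp Require Import all_classical all_reals all_analysis.

Set Implicit Arguments.
Unset Strict Implicit.
Unset Printing Implicit Defensive.

Import Order.TTheory GRing.Theory Num.Theory.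

Local Open Scope ring_scope.

Definition dotv (R : realType) (d : nat) (u v : 'rV[R]_d) : R :=
  \sum_(i < d) u 0 i * v 0 i.

(* The norm [`|u|] that MathComp-Analysis puts on ['rV[R]_d] is the sup norm. *)
Definition enorm (R : realType) (d : nat) (u : 'rV[R]_d) : R :=
  Num.sqrt (dotv u u).

(* Only meaningful for [x != y] and [z != y]: otherwise the quotient is
   [0 / 0 = 0], and [angle x y z] takes the junk value [acos 0 = pi / 2]. *)
Definition angle (R : realType) (d : nat) (x y z : 'rV[R]_d) : R :=
  acos (dotv (x - y) (z - y) / (enorm (x - y) * enorm (z - y))).

Definition angle_eq (R : realType) (d : nat) (a : R) (x y z : 'rV[R]_d) :
    bool :=
  [&& x != y, y != z & angle x y z == a].

(* A tuple (x_1, ..., x_(k+2)) is [t : k.+2.-tuple E] with x_(j+1) as its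
   entry number j; the [inord]s below are always in range. *)
Definition angle_chains (R : realType) (d k : nat) (a : R)
    (E : {fset 'rV[R]_d}) : {set k.+2.-tuple E} :=
  [set t : k.+2.-tuple E | [forall j : 'I_k,
     angle_eq a (val (tnth t (inord j)))
                (val (tnth t (inord j.+1)))
                (val (tnth t (inord j.+2)))]].

(* Main.v *)
(* Split R^6 into three orthogonal planes with a fixed unit vector e in each,
   and let the circles below be those with diameter [0, e] (Thales: if u is on
   the circle then u is orthogonal to u - e).  A point of class r mod 6 has its
   component in the plane p on the circle if r - p = 0, 3 mod 6, equal to 0 if
   r - p = 1, 2 and equal to e if r - p = 4, 5.  If x, y, z have consecutive
   classes, then in each plane other than that of the circle of y one of x - y
   and z - y vanishes, and in the latter plane x and z are the two ends of the
   diameter, so that x - y and z - y are orthogonal.  Hence all tuples whose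
   j-th entry has class j mod 6 are counted. *)

Require Import Defs.
From HB Require Import structures.
From mathcomp Require Import all_boot all_order all_algebra finmap.
From mathcomp Require Import all_classical all_reals all_analysis.
From mathcomp Require Import zify ring.

Import Order.TTheory GRing.Theory Num.Theory.

Local Open Scope ring_scope.

(* Coordinates [2 p] and [2 p + 1] span the plane [p]; the circle is
   parametrized by the slope [s], as [(1, s) / (1 + s ^+ 2)]. *)
Definition class_coord (R : realType) (r c : nat) (s : R) : R :=
  let e := ((r + 6 - c./2) %% 6)%N in
  if (e %% 3 == 0)%N then (if odd c then s else 1) / (1 + s ^+ 2)
  else if ~~ odd c && (3 < e)%N then 1 else 0.

(** The slope [i.+1] is never 0, so the circle component avoids the end [e] of the diameter as well
    as 0. *)
Definition class_point (R : realType) (i : nat) : 'rV[R]_6 :=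
  \row_(c < 6) class_coord R (i %% 6) c i.+1%:R.

Lemma onePsqr_neq0 (R : realType) (s : R) : 1 + s ^+ 2 != 0.
Proof. by rewrite gt_eqF// ltr_pwDl// sqr_ge0. Qed.

Lemma class_coord_orthogonal (R : realType) (r : nat) (s0 s1 s2 : R) :
  \sum_(c < 6)
    (class_coord R (r %% 6) c s0 - class_coord R (r.+1 %% 6) c s1) *
    (class_coord R (r.+2 %% 6) c s2 - class_coord R (r.+1 %% 6) c s1) = 0.
Proof.
have h0 := onePsqr_neq0 R s0; have h1 := onePsqr_neq0 R s1.
have h2 := onePsqr_neq0 R s2.
rewrite -(addn2 r) -(addn1 r) -(modnDml r 1) -(modnDml r 2).
have : (r %% 6 < 6)%N by rewrite ltn_mod.
rewrite !big_ord_recl big_ord0 /class_coord.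
(* For each of the six residues this is an identity of rational functions in the slopes. *)
by case: (r %% 6)%N => [|[|[|[|[|[|//]]]]]] _ /=; field; do ?[apply/andP; split].
Qed.

Lemma class_point_inj (R : realType) : injective (class_point R).
Proof.
move=> i j /rowP eq_ij.
have coordE c : (c < 6)%N ->
    class_coord R (i %% 6) c i.+1%:R = class_coord R (j %% 6) c j.+1%:R.
  by move=> c_lt; move: (eq_ij (Ordinal c_lt)); rewrite !mxE.
pose p := (i %% 3)%N; have p_lt : (p < 3)%N by rewrite ltn_mod.
have ip : ((i %% 6 + 6 - p) %% 6 %% 3 == 0)%N by rewrite /p; lia.
have := coordE p.*2 ltac:(lia); have := coordE p.*2.+1 ltac:(lia).
rewrite /class_coord /= uphalf_double doubleK odd_double /= ip.
have ni := onePsqr_neq0 R (i.+1%:R); have nj := onePsqr_neq0 R (j.+1%:R).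
(* If [j] has no circle component in the plane [p], its odd coordinate there is 0, while that of [i]
   is not. Otherwise the even coordinates give equal denominators, and then the odd ones equal
   slopes. *)
case: ifP => _; last first.
  by move/eqP; rewrite mulf_eq0 invr_eq0 (negPf ni) orbF pnatr_eq0.
move=> eq_y eq_x; have : i.+1%:R = j.+1%:R :> R.
  have inv_eq : (1 + i.+1%:R ^+ 2)^-1 = (1 + j.+1%:R ^+ 2)^-1 :> R.
    by rewrite -[LHS]mul1r -[RHS]mul1r.
  by move: eq_y; rewrite inv_eq => /mulIf; apply; rewrite invr_eq0.
by move/eqP; rewrite eqr_nat => /eqP [].
Qed.

Lemma class_point_angle (R : realType) (r i0 i1 i2 : nat) :
  i0 = r %[mod 6] -> i1 = r.+1 %[mod 6] -> i2 = r.+2 %[mod 6] ->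
  angle_eq (pi / 2) (class_point R i0) (class_point R i1) (class_point R i2).
Proof.
move=> h0 h1 h2; rewrite /angle_eq !(inj_eq (class_point_inj R)).
apply/and3P; split; [lia | lia |].
suff -> : angle (class_point R i0) (class_point R i1) (class_point R i2) =
    acos 0 by rewrite acos0.
rewrite /angle (_ : dotv _ _ = 0) ?mul0r//.
rewrite -[RHS](class_coord_orthogonal R r i0.+1%:R i1.+1%:R i2.+1%:R).
by apply: eq_bigr => c _; rewrite !mxE h0 h1 h2.
Qed.

Local Open Scope fset_scope.

Definition class_fset (R : realType) (n : nat) : {fset 'rV[R]_6} :=
  [fset class_point R (i : 'I_n) | i in 'I_n].

Lemma card_class_fset (R : realType) (n : nat) : #|` class_fset R n| = n.
Proof.
rewrite card_imfset/=; first by rewrite -cardE card_ord.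
by move=> i j /(class_point_inj R) /val_inj.
Qed.

Lemma card_angle_chains_le (R : realType) (d k : nat) (a : R)
    (E : {fset 'rV[R]_d}) :
  (#|angle_chains k a E| <= #|` E| ^ (k + 2))%N.
Proof. by rewrite addn2 cardfE -card_tuple max_card. Qed.

Lemma card_angle_chains_class_fset (R : realType) (k n : nat) :
  ((n %/ 6) ^ (k + 2) <= #|angle_chains k (pi / 2) (class_fset R n)|)%N.
Proof.
(* Each of the [n %/ 6] complete blocks of six indices contains one index of every class, so each
   entry of a chain is a free choice of a block [m]. *)
have idx_lt (m : 'I_(n %/ 6)) (j : nat) : (m * 6 + j %% 6 < n)%N.
  by have := ltn_ord m; lia.
pose idx m j : 'I_n := Ordinal (idx_lt m j).
have in_E (i : 'I_n) : class_point R i \in class_fset R n.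
  by apply/imfsetP; exists i.
pose chain (t : k.+2.-tuple 'I_(n %/ 6)) : k.+2.-tuple (class_fset R n) :=
  [tuple [` in_E (idx (tnth t j) j)] | j < k.+2].
have chain_inj : injective chain.
  move=> t t' /(congr1 (fun u => tnth u)) eq_tt'.
  apply: eq_from_tnth => j; move: (congr1 (fun f => val (f j)) eq_tt').
  rewrite !tnth_mktuple /= => /(class_point_inj R) eq_idx.
  by apply: val_inj => /=; lia.
rewrite addn2 -[X in (X ^ _)%N]card_ord -card_tuple -(card_imset _ chain_inj).
apply/subset_leq_card/fintype.subsetP => _ /imsetP[t _ ->].
rewrite inE; apply/forallP => j; rewrite !tnth_mktuple /=.
have j_lt := ltn_ord j.
by apply: (class_point_angle R j); rewrite inordK ?modnMDl ?modn_mod//; lia.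
Qed.

Theorem theorem5p2 (R : realType) (k : nat) (k_gt0 : (0 < k)%N) :
  exists (c C : R) (N : nat),
    [/\ 0 < c, 0 < C, (0 < N)%N &
      forall n : nat, (N < n)%N ->
        exists E : {fset 'rV[R]_6},
          #|` E| = n /\
          c * n%:R ^+ (k + 2) <= #|angle_chains k (pi / 2) E|%:R
                              <= C * n%:R ^+ (k + 2)].
Proof.
(* With [q = n %/ 6 >= 1] one has [n <= 6 * q + 5 <= 12 * q], hence the factor 1/12 per entry. *)
exists (12%:R^-1 ^+ (k + 2)), 1, 6%N; split => // n n_gt6.
exists (class_fset R n); split; first exact: card_class_fset.
rewrite mul1r -exprMn; apply/andP; split; last first.
  have := card_angle_chains_le R 6 k (pi / 2) (class_fset R n).
  by rewrite card_class_fset -natrX ler_nat.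
apply: le_trans (_ : (n %/ 6)%:R ^+ (k + 2) <= _); last first.
  by rewrite -natrX ler_nat card_angle_chains_class_fset.
apply: lerXn2r; rewrite ?nnegrE ?mulr_ge0//.
by rewrite mulrC ler_pdivrMr// -natrM ler_nat; lia.
Qed.
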